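(* Let $X$ be a paracompact Hausdorff space and let $\mu$ be an ordinal with $0<\mu\leq\omega+1$. The following are equivalent: (a) Each sequence $\mathscr{U}_n$, $n<\omega$, of open covers of $X$ has a $C$-refinement $\mathscr{V}_n$, $n<\kappa$, for some $0<\kappa<\mu$. (b) Each sequence $\mathscr{U}_n$, $n<\omega$, of open covers of $X$ admits a canonical map $f:X\to|\Delta(\mathscr{U}_{<\kappa})|$ for some $0<\kappa<\mu$.
   Context: Ordinals are used: $\kappa$ ranges over ordinals with $0<\kappa\leq\omega$, and $n<\kappa$ ranges over the natural numbers less than $\kappa$. $C$-refinement: for a sequence $\mathscr{U}_n$, $n<\omega$, of open covers of $X$ and $0<\kappa\leq\omega$, a sequence $\mathscr{V}_n$, $n<\kappa$, of pairwise-disjoint families of open subsets of $X$ is a $C$-refinement of $\mathscr{U}_n$, $n<\omega$, if each $\mathscr{V}_n$ refines $\mathscr{U}_n$ (every member of $\mathscr{V}_n$ is contained in some member of $\mathscr{U}_n$) and $\bigcup_{n<\kappa}\mathscr{V}_n$ covers $X$. Simplicial complexes: a simplicial complex is a collection $\Sigma$ of nonempty finite sets closed under taking nonempty subsets; its vertex set is $\Sigma^0=\bigcup\Sigma$. Embedding the vertices as a linearly independent subset of a normed linear space, $|\sigma|$ is the convex hull of $\sigma\in\Sigma$, and $|\Sigma|=\bigcup_{\sigma\in\Sigma}|\sigma|$ is the geometric realisation, endowed with the Whitehead topology ($U\subset|\Sigma|$ is open iff $U\cap|\sigma|$ is open in $|\sigma|$ for every $\sigma\in\Sigma$). $\langle\sigma\rangle$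 is the relative interior of $|\sigma|$, and the open star of a vertex $v$ is $\mathrm{st}\langle v\rangle=\bigcup_{v\in\sigma\in\Sigma}\langle\sigma\rangle$. The complex $\Delta(\mathscr{U}_{<\kappa})$: for families $\mathscr{U}_n$, $n<\kappa$, of subsets of $X$ whose union covers $X$, let $\bigsqcup_{n<\kappa}\mathscr{U}_n=\bigcup_{n<\kappa}\mathscr{U}_n\times\{n\}$ be their disjoint union, regarded as a cover of $X$ in which the index $(U,n)$ represents the set $U$. For a nonempty finite set $\sigma$ of such indices, $\ker[\sigma]=\bigcap_{(U,n)\in\sigma}U$. The nerve $\mathscr{N}(\mathscr{U}_{<\kappa})$ consists of all such $\sigma$ with $\ker[\sigma]\neq\varnothing$, and $\Delta(\mathscr{U}_{<\kappa})$ is its subcomplex of those $\sigma$ which contain at most one element of $\mathscr{U}_n\times\{n\}$ for each $n<\kappa$. Canonical map: a continuous map $f:X\to|\Delta(\mathscr{U}_{<\kappa})|\subset|\mathscr{N}(\mathscr{U}_{<\omega})|$ is canonical for the sequence $\mathscr{U}_n$, $n<\omega$, if $f^{-1}(\mathrm{st}\langle (U,n)\rangle)\subset U$ for every vertex $(U,n)$. *)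

(* Defs.v *)
From HB Require Import structures.
From mathcomp Require Import all_boot all_order all_algebra finmap.
From mathcomp Require Import all_classical all_reals all_analysis.

Set Implicit Arguments.
Unset Strict Implicit.
Unset Printing Implicit Defensive.

Import Order.TTheory GRing.Theory Num.Theory.
Import numFieldNormedType.Exports.

Local Open Scope classical_set_scope.
Local Open Scope ring_scope.

(* [(a, b)] stands for the ordinal omega * a + b.  The order of this type, that
   of the ordinals below omega ^ 2, is the lexicographic one. *)
Notation ordinal2 := (nat *l nat)%type.
Definition ord_fin (n : nat) : ordinal2 := (0%N, n).
Definition ord_omega : ordinal2 := (1%N, 0%N).
Definition ord_omegaS : ordinal2 := (1%N, 1%N).

Section covers.
Context {X : topologicalType}.
Implicit Types (U V : set (set X)).

Definition is_cover U := \bigcup_(A in U) A = [set: X].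

Definition is_open_cover U := (forall A, U A -> open A) /\ is_cover U.

Definition refines V U := forall B, V B -> exists2 A, U A & B `<=` A.

Definition locally_finite U := forall x : X,
  exists2 N : set X, nbhs x N & finite_set [set A | U A /\ A `&` N !=set0].

Definition C_refinement (U : nat -> set (set X)) (kappa : ordinal2)
    (V : nat -> set (set X)) :=
  [/\ forall n, (ord_fin n < kappa)%O ->
        [/\ trivIset (V n) id, forall B, V n B -> open B & refines (V n) (U n)]
    & is_cover (\bigcup_(n in [set n | (ord_fin n < kappa)%O]) V n)].

End covers.

Definition paracompact (X : topologicalType) :=
  forall U : set (set X), is_open_cover U ->
  exists V : set (set X), [/\ is_open_cover V, refines V U & locally_finite V].

Section hulls.
Context {R : realType} {E : normedModType R}.
Implicit Types A C : set E.

(* A finitely supported sum vanishes by convention when its support is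
   infinite, so that the sum of the weights being 1 forces them to be finitely
   supported on [A]. *)
Definition convex_hull A : set E :=
  [set x | exists t : E -> R, [/\ forall a, A a -> 0 <= t a,
     \sum_(a \in A) t a = 1 & x = \sum_(a \in A) t a *: a]].

Definition affine_hull A : set E :=
  [set x | exists t : E -> R,
     \sum_(a \in A) t a = 1 /\ x = \sum_(a \in A) t a *: a].

Definition relative_interior C : set E :=
  [set x | C x /\ within (affine_hull C) (nbhs x) C].

End hulls.

Section free_normed.
Context (R : realType) (V : choiceType).

Definition finsupp_pred : {pred V -> R} :=
  [pred f | `[< finite_set [set v | f v != 0] >]].

Lemma finsuppP (f : V -> R) :
  (f \in finsupp_pred) <-> finite_set [set v | f v != 0].
Proof. by rewrite unfold_in; split=> [/asboolP|ff] //; apply/asboolP. Qed.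

Lemma finsupp_submod_closed : submod_closed finsupp_pred.
Proof.
split=> [|a f g /finsuppP ff /finsuppP fg]; apply/finsuppP.
  by rewrite (_ : [set _ | _] = set0)// -subset0 => v /=; rewrite eqxx.
apply: (sub_finite_set (B := [set v | f v != 0] `|` [set v | g v != 0])).
  move=> v /= afgv; have [fv|] := eqVneq (f v) 0; last by left.
  right; apply: contra_neq afgv => gv.
  by rewrite (_ : _ v = a * f v + g v)// fv gv mulr0 addr0.
by rewrite finite_setU.
Qed.

HB.instance Definition _ :=
  GRing.isSubmodClosed.Build R (V -> R) finsupp_pred finsupp_submod_closed.

(* The linear space of finitely supported functions with the l^1 norm: a normed
   space in which the points of [V] embed as a linearly independent set. *)
Definition free_normed := {f : V -> R | f \in finsupp_pred}.

HB.instance Definition _ := SubType.on free_normed.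
HB.instance Definition _ := [Choice of free_normed by <:].
HB.instance Definition _ := [SubChoice_isSubLmodule of free_normed by <:].

Implicit Types x y : free_normed.

Lemma free_normed_fin x : finite_set [set v | val x v != 0].
Proof. exact/finsuppP/valP. Qed.

Lemma free_normedDE x y v : val (x + y) v = val x v + val y v.
Proof. by []. Qed.

Lemma free_normedZE (a : R) x v : val (a *: x) v = a * val x v.
Proof. by []. Qed.

Definition l1_norm x : R := \sum_(v \in [set: V]) `|val x v|.

Lemma l1_normE x (B : set V) : finite_set B -> [set v | val x v != 0] `<=` B ->
  l1_norm x = \sum_(v \in B) `|val x v|.
Proof.
move=> fB sB; rewrite /l1_norm; apply/esym/fsbig_widen => // v [_ nBv] /=.
by have [->|/sB//] := eqVneq (val x v) 0; rewrite normr0.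
Qed.

Lemma l1_normD x y : l1_norm (x + y) <= l1_norm x + l1_norm y.
Proof.
pose B := [set v | val x v != 0] `|` [set v | val y v != 0].
have fB : finite_set B by rewrite finite_setU; split; exact: free_normed_fin.
rewrite (@l1_normE x B)//; last by move=> v; left.
rewrite (@l1_normE y B)//; last by move=> v; right.
rewrite (@l1_normE (x + y) B)//; last first.
  suff xyB v : val x v + val y v != 0 -> B v by move=> v; exact: xyB.
  move=> xyv; have [xv|] := eqVneq (val x v) 0; last by left.
  by right; apply: contra_neq xyv => yv; rewrite xv yv addr0.
rewrite !fsbig_finite// -big_split; apply: ler_sum => v _.
exact: ler_normD.
Qed.

Lemma l1_normZ (a : R) x : l1_norm (a *: x) = `|a| * l1_norm x.
Proof.
have fx := free_normed_fin x.
have axB : [set v | val (a *: x) v != 0] `<=` [set v | val x v != 0].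
  suff axB v : a * val x v != 0 -> val x v != 0 by move=> v; exact: axB.
  by apply: contra_neq => ->; rewrite mulr0.
rewrite (l1_normE fx axB) (l1_normE fx)// !fsbig_finite// mulr_sumr.
by apply: eq_bigr => v _; exact: normrM.
Qed.

Lemma l1_norm0_eq0 x : l1_norm x = 0 -> x = 0.
Proof.
have fx := free_normed_fin x.
rewrite (l1_normE fx)// fsbig_finite//= => /eqP.
rewrite psumr_eq0 // => /allP x0; apply/val_inj/funext => v.
have [->//|xv] := eqVneq (val x v) 0.
have /x0 : v \in fset_set [set v | val x v != 0] by rewrite in_fset_set// inE.
by rewrite normr_eq0 => /eqP.
Qed.

HB.instance Definition _ := Lmodule_isNormed.Build R free_normed
  l1_normD l1_normZ l1_norm0_eq0.

Lemma dirac_finsupp (v : V) :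
  (fun w => if w == v then 1 else 0 : R) \in finsupp_pred.
Proof.
apply/finsuppP; apply: (sub_finite_set (B := [set v])) => // w /=.
by have [//|_] := eqVneq w v; rewrite eqxx.
Qed.

Definition vertex_pt (v : V) : free_normed :=
  exist (fun f => f \in finsupp_pred) _ (dirac_finsupp v).

Lemma val_fsum_vertex (s : set V) (t : V -> R) (w : V) : finite_set s -> s w ->
  val (\sum_(v \in s) t v *: vertex_pt v) w = t w.
Proof.
move=> fs sw; rewrite fsbig_finite//.
rewrite (big_morph (fun x : free_normed => val x w)
  (fun x y => free_normedDE x y w) (erefl : val (0 : free_normed) w = 0)).
have ws : w \in fset_set s by rewrite in_fset_set// inE.
rewrite (big_fsetD1 w)// big1_fset => [|v].
  by rewrite free_normedZE /= eqxx mulr1 addr0.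
rewrite !inE => /andP[vw _] _; rewrite free_normedZE /=.
by rewrite eq_sym (negPf vw) mulr0.
Qed.

Lemma vertex_pt_free (s : set V) (t : V -> R) : finite_set s ->
  \sum_(v \in s) t v *: vertex_pt v = 0 -> forall v, s v -> t v = 0.
Proof. by move=> fs t0 v sv; rewrite -(val_fsum_vertex t fs sv) t0. Qed.

End free_normed.

Record simplicial_complex (V : Type) := SimplicialComplex {
  simplices : set (set V) ;
  simplex_finite : forall s, simplices s -> finite_set s ;
  simplex_nonempty : forall s, simplices s -> s !=set0 ;
  simplex_face : forall s t, simplices s -> t !=set0 -> t `<=` s -> simplices t
}.

Definition vertices (V : Type) (S : simplicial_complex V) : set V :=
  \bigcup_(s in simplices S) s.

Section realisation.
Context (R : realType) (V : choiceType).
Implicit Types S : simplicial_complex V.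

Definition closed_simplex (s : set V) : set (free_normed R V) :=
  convex_hull (@vertex_pt R V @` s).

Definition open_simplex (s : set V) : set (free_normed R V) :=
  relative_interior (closed_simplex s).

Definition polyhedron S : set (free_normed R V) :=
  \bigcup_(s in simplices S) closed_simplex s.

Definition open_star S (v : V) : set (free_normed R V) :=
  \bigcup_(s in [set s | simplices S s /\ s v]) open_simplex s.

Definition realisation S := {x : free_normed R V | x \in polyhedron S}.

Section whitehead.
Context (S : simplicial_complex V).

HB.instance Definition _ := SubType.on (realisation S).
HB.instance Definition _ := [Choice of realisation S by <:].

Definition whitehead_open : set_system (realisation S) :=
  [set U | forall s, simplices S s -> exists2 W : set (free_normed R V),
     open W & (val @` U) `&` closed_simplex s = W `&` closed_simplex s].

Lemma whitehead_openT : whitehead_open setT.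
Proof.
move=> s Ss; exists setT; first exact: openT.
rewrite setTI; apply/seteqP; split=> [x []//|x sx]; split=> //.
have xS : x \in polyhedron S by rewrite inE; exists s.
by exists (exist (fun x => x \in polyhedron S) x xS).
Qed.

Lemma whitehead_openI : setI_closed whitehead_open.
Proof.
move=> A B oA oB s Ss; have [W oW AW] := oA s Ss; have [W' oW' BW'] := oB s Ss.
exists (W `&` W'); first exact: openI.
rewrite setIIl -AW -BW' -setIIl; congr (_ `&` _).
apply/seteqP; split=> [x [y [Ay By] <-]|x [[y Ay yx] [z Bz zx]]].
  by split; exists y.
by exists y => //; split=> //; rewrite (_ : y = z)//; apply: val_inj; rewrite yx.
Qed.

Lemma whitehead_open_bigU (I : Type) (f : I -> set (realisation S)) :
  (forall i, whitehead_open (f i)) -> whitehead_open (\bigcup_i f i).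
Proof.
move=> fo s Ss.
have /choice[W oW] i : exists W : set (free_normed R V), open W /\
    (val @` f i) `&` closed_simplex s = W `&` closed_simplex s.
  by have [W oW fW] := fo i s Ss; exists W.
exists (\bigcup_i W i); first by apply: bigcup_open => i _; have [] := oW i.
rewrite image_bigcup !setI_bigcupl; apply: eq_bigcupr => i _.
by have [] := oW i.
Qed.

HB.instance Definition _ := isOpenTopological.Build (realisation S)
  whitehead_openT whitehead_openI whitehead_open_bigU.

End whitehead.
End realisation.

Section nerve.
Context {X : Type}.
Implicit Types (U : nat -> set (set X)) (kappa : ordinal2).

(* The index [(A, n)] represents the member [A] of the n-th family. *)
Definition disjoint_union kappa U : set (set X * nat) :=
  [set v | (ord_fin v.2 < kappa)%O /\ U v.2 v.1].

Definition ker (s : set (set X * nat)) : set X := \bigcap_(v in s) v.1.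

Definition nerve_simplices kappa U : set (set (set X * nat)) :=
  [set s | [/\ finite_set s, s !=set0, s `<=` disjoint_union kappa U
             & ker s !=set0]].

Definition Delta_simplices kappa U : set (set (set X * nat)) :=
  [set s | nerve_simplices kappa U s /\
     forall v w, s v -> s w -> v.2 = w.2 -> v = w].

Lemma nerve_face kappa U s t : nerve_simplices kappa U s ->
  t !=set0 -> t `<=` s -> nerve_simplices kappa U t.
Proof.
move=> [fs _ sU [x sx]] t0 ts; split=> //.
- exact: sub_finite_set fs.
- exact: subset_trans sU.
- by exists x => v /ts; exact: sx.
Qed.

Lemma Delta_face kappa U s t : Delta_simplices kappa U s ->
  t !=set0 -> t `<=` s -> Delta_simplices kappa U t.
Proof.
move=> [Ns s1] t0 ts; split; first exact: nerve_face Ns t0 ts.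
by move=> v w /ts sv /ts; exact: s1.
Qed.

Definition nerve kappa U : simplicial_complex (set X * nat) :=
  @SimplicialComplex _ (nerve_simplices kappa U)
    (fun _ '(And4 fs _ _ _) => fs) (fun _ '(And4 _ s0 _ _) => s0)
    (@nerve_face kappa U).

Definition Delta kappa U : simplicial_complex (set X * nat) :=
  @SimplicialComplex _ (Delta_simplices kappa U)
    (fun _ '(conj (And4 fs _ _ _) _) => fs)
    (fun _ '(conj (And4 _ s0 _ _) _) => s0)
    (@Delta_face kappa U).

End nerve.

(* The open stars are those of the nerve of the whole sequence, whose
   realisation contains that of [Delta kappa U]. *)
Definition canonical_map (R : realType) (X : topologicalType)
    (U : nat -> set (set X)) (kappa : ordinal2)
    (f : X -> realisation R (Delta kappa U)) :=
  continuous f /\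
  forall v, vertices (nerve ord_omega U) v ->
    [set x | open_star (nerve ord_omega U) v (val (f x))] `<=` v.1.

(* Main.v *)
Require Import Defs.
From mathcomp Require Import all_boot all_order all_algebra finmap.
From mathcomp Require Import all_classical all_reals all_analysis.
From mathcomp Require Import lra.

(** If [f] is canonical, the sets of the [x] such that [f x] has a nonzero
    coordinate at [(A, n)], for [A] in [U n], form the n-th family of a
    C-refinement: two of them are disjoint because a simplex of [Delta kappa U] has at most one vertex of
    level [n].

    Conversely, let [V] be a C-refinement, and [xi n] a locally finite partition
    of unity such that [xi n] vanishes near every point outside the union [W n]
    of [V n].  Each point [x] of [W n] lies in a unique member of [V n]; let
    [u n x] be a member of [U n] which contains it.  Then
    [f x = \sum_n xi n x *: (u n x, n)] is canonical.  It is continuous for the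
    Whitehead topology because near each point it takes its values in a single
    closed simplex, [u n] being locally constant on [W n]. *)

Set Implicit Arguments.
Unset Strict Implicit.
Unset Printing Implicit Defensive.

Import Order.TTheory GRing.Theory Num.Theory.
Import numFieldNormedType.Exports.

(** * Separation and shrinking of covers in paracompact Hausdorff spaces *)

Section paracompact_hausdorff.
Local Open Scope classical_set_scope.
Context {X : topologicalType}.
Implicit Types (x y : X) (A B C D N E : set X) (U V W : set (set X)).

(** Only finitely many members of [W] meet a suitable neighbourhood [N] of [x], and the union of
    their closures is closed. If it missed [x], removing it from [N] would leave a neighbourhood of
    [x] disjoint from every member of [W]. *)
Lemma closure_bigcup_locally_finite V W : locally_finite V -> W `<=` V ->
  closure (\bigcup_(A in W) A) `<=` \bigcup_(A in W) closure A.
Proof.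
move=> lfV WV x clx; have [N Nx finN] := lfV x.
pose F := [set A | W A /\ A `&` N !=set0].
have clF : closed (\bigcup_(A in F) closure A).
  apply: closed_bigcup => [|A _]; last exact: closed_closure.
  by apply: sub_finite_set finN => A [WA AN]; split=> //; exact: WV.
have [[A [WA _] Ax]|nFx] := pselect ((\bigcup_(A in F) closure A) x).
  by exists A.
have := clx (N `&` ~` (\bigcup_(A in F) closure A)).
have oF : open (~` (\bigcup_(A in F) closure A)) by exact: closed_openC.
case=> [|y [[A WA Ay] [Ny nFy]]].
  by apply: filterI => //; exact: open_nbhs_nbhs.
case: nFy; exists A; last exact: subset_closure.
by split=> //; exists y.
Qed.

Lemma paracompact_separate C D : paracompact X -> closed C ->
  (forall x, C x -> exists2 E, open E /\ E x & closure E `&` D = set0) ->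
  exists2 G, open G /\ C `<=` G & closure G `&` D = set0.
Proof.
move=> paraX clC sepC.
pose U := [set E | open E /\ (E `<=` ~` C \/ closure E `&` D = set0)].
have [|V [[oV cV] VU lfV]] := paraX U.
  split=> [A []//|]; apply/seteqP; split=> // x _.
  have [/sepC[E [oE Ex] ED]|nCx] := pselect (C x).
    by exists E => //; split=> //; right.
  by exists (~` C) => //; split; [exact: closed_openC|left].
pose W := [set A | V A /\ A `&` C !=set0].
have WV : W `<=` V by move=> A [].
exists (\bigcup_(A in W) A).
  split; first by apply: bigcup_open => A /WV; exact: oV.
  move=> x Cx; have [A VA Ax] : (\bigcup_(A in V) A) x by rewrite cV.
  by exists A => //; split=> //; exists x.
rewrite -subset0 => x [/(closure_bigcup_locally_finite lfV WV) clx Dx].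
case: clx => A [VA [y [Ay Cy]]] clAx.
have [E [oE [EC|ED]] AE] := VU _ VA; first by case: (EC _ (AE _ Ay)).
by rewrite -ED; split=> //; exact: closureS clAx.
Qed.

Lemma paracompact_hausdorff_regular C y : paracompact X -> hausdorff_space X ->
  closed C -> ~ C y -> exists2 G, open G /\ C `<=` G & ~ closure G y.
Proof.
move=> paraX hausX clC nCy.
have [x Cx|G oCG Gy] := @paracompact_separate C [set y] paraX clC.
  have xy : x != y by apply/eqP => xy; apply: nCy; rewrite -xy.
  move: hausX; rewrite open_hausdorff => /(_ _ _ xy).
  move=> [[A B] /= [/set_mem Ax /set_mem By] [oA oB /eqP AB]].
  exists A => //; rewrite -subset0 => z [+ zy]; rewrite {z}zy => clA.
  have [|z ABz] := clA B; first exact: open_nbhs_nbhs.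
  by have : set0 z by rewrite -AB.
by exists G => // clGy; have : set0 y by rewrite -Gy.
Qed.

Lemma paracompact_hausdorff_nbhs_closure x E : paracompact X ->
  hausdorff_space X -> open E -> E x -> exists2 G, open G /\ G x & closure G `<=` E.
Proof.
move=> paraX hausX oE Ex.
have [||G [oG EG] clGx] := @paracompact_hausdorff_regular (~` E) x paraX hausX.
- exact: open_closedC.
- by [].
exists (~` closure G); first by split=> //; apply: closed_openC; exact: closed_closure.
have clnG : closed (~` G) by exact: open_closedC.
move=> z clz; apply: contrapT => /EG Gz.
have : closure (~` G) z.
  by apply: closureS clz; apply: subsetC; exact: subset_closure.
by move/clnG.
Qed.

Lemma paracompact_hausdorff_normal : paracompact X -> hausdorff_space X ->
  forall C D, closed C -> closed D -> C `&` D = set0 ->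
  exists A B, [/\ open A, open B, C `<=` A, D `<=` B & A `&` B = set0].
Proof.
move=> paraX hausX C D clC clD CD.
have [x Cx|G [oG CG] GD] := @paracompact_separate C D paraX clC.
  have [||E [oE Ex] ED] := @paracompact_hausdorff_nbhs_closure x (~` D) paraX hausX.
  - exact: closed_openC.
  - by move=> Dx; have : set0 x by rewrite -CD.
  by exists E => //; exact/disjoints_subset.
exists G, (~` closure G); split=> //.
- by apply: closed_openC; exact: closed_closure.
- by move=> x Dx clx; have : set0 x by rewrite -GD.
- by apply/disjoints_subset; rewrite setCK; exact: subset_closure.
Qed.

(** By regularity the open sets whose closure lies in some [W i] cover [X]. [H i] collects the
    members of a locally finite refinement whose closure lies in [W i], and local finiteness carries
    this inclusion over to the closure of the union. *)
Lemma paracompact_hausdorff_shrink (I : Type) (W : I -> set X) :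
  paracompact X -> hausdorff_space X -> (forall i, open (W i)) ->
  \bigcup_i W i = setT ->
  exists H : I -> set X, [/\ forall i, open (H i), \bigcup_i H i = setT
    & forall i, closure (H i) `<=` W i].
Proof.
move=> paraX hausX oW cW.
have [|V [[oV cV] VU lfV]] := paraX [set E | open E /\ exists i, closure E `<=` W i].
  split=> [A []//|]; apply/seteqP; split=> // x _.
  have [i _ Wx] : (\bigcup_i W i) x by rewrite cW.
  have [E [oE Ex] EW] := paracompact_hausdorff_nbhs_closure paraX hausX (oW i) Wx.
  by exists E => //; split=> //; exists i.
pose H i := \bigcup_(A in [set A | V A /\ closure A `<=` W i]) A.
exists H; split=> [i||i x].
- by apply: bigcup_open => A [VA _]; exact: oV.
- apply/seteqP; split=> // x _.
  have [A VA Ax] : (\bigcup_(A in V) A) x by rewrite cV.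
  have [E [_ [i EW]] AE] := VU _ VA.
  exists i => //; exists A => //; split=> //.
  by apply: subset_trans EW; exact: closureS.
- by move/(closure_bigcup_locally_finite lfV (fun _ '(conj VA _) => VA)) => [A [_]]; apply.
Qed.

End paracompact_hausdorff.

(** * Bump functions and locally finite partitions of unity *)

Section partition_of_unity.
Local Open Scope classical_set_scope.
Local Open Scope ring_scope.
Context {R : realType} {X : topologicalType}.

Lemma paracompact_hausdorff_bump (C D : set X) :
  paracompact X -> hausdorff_space X -> closed C -> open D -> C `<=` D ->
  exists h : X -> R, [/\ continuous h, forall x, 0 <= h x,
    forall x, C x -> h x = 1 & forall x, ~ D x -> \forall y \near x, h y = 0].
Proof.
move=> paraX hausX clC oD CD.
have CD0 : ~` D `&` C = set0 by apply/disjoints_subset; exact: subsetC.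
have /(@normal_openP R)/(@normal_separatorP R) nX :=
  paracompact_hausdorff_normal paraX hausX.
have /(@uniform_separatorP _ R) [g [cg g01 gD gC]] := nX _ _ (open_closedC oD) clC CD0.
(* A Urysohn function [g] vanishes only at the points outside [D]. Cutting it off below 1/2 makes
   the result vanish on the open set [g < 1/2], hence near each of them. *)
exists (fun x => Num.max 0 (2 * g x - 1)); split=> [x|x|x Cx|x nDx].
- apply: (@continuous_max R X (fun=> 0) (fun x => 2 * g x - 1)); first exact: cvg_cst.
  by apply: cvgB; [apply: cvgM; [exact: cvg_cst|exact: cg]|exact: cvg_cst].
- by rewrite le_max lexx.
- have gx : g x = 1 by apply: gC; exists x.
  by rewrite gx mulr1 [_ - _](_ : _ = 1) ?max_r//; lra.
- have gx : g x = 0 by apply: gD; exists x.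
  have : \forall y \near x, g y < 1 / 2.
    by apply: (cvgr_lt (g x)) (cg x) _ _; rewrite gx; lra.
  by apply: filterS => y gy; rewrite max_l//; lra.
Qed.

Lemma paracompact_hausdorff_partition (W : nat -> set X) :
  paracompact X -> hausdorff_space X ->
  (forall n, open (W n)) -> \bigcup_n W n = setT ->
  exists xi : nat -> X -> R, [/\ forall n, continuous (xi n),
    forall n x, 0 <= xi n x,
    forall n (x : X), ~ W n x -> \forall y \near x, xi n y = 0 &
    forall x : X, exists m, \forall y \near x,
      (forall n, (m <= n)%N -> xi n y = 0) /\ \sum_(n < m) xi n y = 1].
Proof.
move=> paraX hausX oW cW.
have [H [oH cH HW]] := paracompact_hausdorff_shrink paraX hausX oW cW.
have /choice [h hP] n := paracompact_hausdorff_bump paraX hausX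
  (@closed_closure _ (H n)) (oW n) (@HW n).
have h0 n x : 0 <= h n x by have [] := hP n.
pose s n x : R := \sum_(k < n) h k x.
(* Truncating the partial sums at 1 and taking differences yields a partition
   of unity which is locally finite although the supports of the [h n] need not
   be. *)
pose p n x : R := Num.min 1 (s n x).
have p0 x : p 0%N x = 0 by rewrite /p /s big_ord0 min_r.
exists (fun n x => p n.+1 x - p n x).
have cs n : continuous (s n).
  move=> x; apply: (@cvg_big R^o _ +%R 0 xpredT (@add_continuous _)) => // k _.
  by have [ch _ _ _] := hP k; exact: ch.
have cp n : continuous (p n).
  by move=> x; apply: (@continuous_min R X (fun=> 1) (s n)); [exact: cvg_cst|exact: cs].
split=> [n x|n x|n x nWx|x].
- by apply: cvgB; exact: cp.
- rewrite subr_ge0 /p /s big_ord_recr /= le_min ge_min lexx /=.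
  by rewrite ge_min lerDl h0 orbT.
- have [_ _ _ /(_ _ nWx)] := hP n; apply: filterS => y hy.
  by rewrite /p /s big_ord_recr /= hy addr0 subrr.
- have [k _ Hx] : (\bigcup_n H n) x by rewrite cH.
  (* On the neighbourhood [H k] of [x] the function [h k] is 1, so every partial sum that includes
     index [k] is truncated to 1; the later differences vanish and the first [k.+1] telescope to
     1. *)
  exists k.+1.
  have := open_nbhs_nbhs (conj (oH k) Hx); apply: filterS => y Hy.
  have p1 n : (k < n)%N -> p n y = 1.
    move=> kn; rewrite /p min_l// /s (bigD1 (Ordinal kn)) //=.
    have [_ _ h1 _] := hP k; rewrite h1; last exact: subset_closure.
    by rewrite lerDl sumr_ge0.
  split=> [n kn|]; first by rewrite !p1 ?subrr// ltnW.
  rewrite -(big_mkord xpredT (fun n => p n.+1 y - p n y)) telescope_sumr//.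
  by rewrite p1// p0 subr0.
Qed.

End partition_of_unity.

(** * Barycentric coordinates of simplices and open stars *)

Section barycentric_coordinates.
Local Open Scope classical_set_scope.
Local Open Scope ring_scope.
Context {R : realType} {V : choiceType}.
Local Notation E := (free_normed R V).
Implicit Types (x y : E) (v w : V) (s : set V) (S : simplicial_complex V).

Lemma val_sum (I : Type) (r : seq I) (P : pred I) (F : I -> E) v :
  val (\sum_(i <- r | P i) F i) v = \sum_(i <- r | P i) val (F i) v.
Proof.
exact: (big_morph (fun x : E => val x v) (fun x y => free_normedDE x y v) erefl).
Qed.

Lemma coord_le_norm x v : `|val x v| <= `|x|.
Proof.
change (`|val x v| <= l1_norm x).
pose B := [set w | val x w != 0] `|` [set v].
have fB : finite_set B by rewrite finite_setU; split=> //; exact: free_normed_fin.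
rewrite (@l1_normE _ _ x B) //; last by move=> w; left.
have vB : v \in fset_set B by rewrite in_fset_set// inE; right.
by rewrite fsbig_finite// (big_fsetD1 v)//= lerDl sumr_ge0.
Qed.

Lemma coord_continuous v : continuous (fun x : E => val x v : R).
Proof.
move=> x; apply/(@cvgrPdist_lt _ _ _ (nbhs x)) => e e0.
have : nbhs x [set y | `|x - y| < e] by apply/nbhs_normP; exists e.
by apply: filterS => y; apply: le_lt_trans; exact: (coord_le_norm (x - y) v).
Qed.

Lemma coord_open (A : set R) v : open A -> open [set x : E | A (val x v)].
Proof. by move=> oA; apply: open_comp oA => x _; exact: coord_continuous. Qed.

Lemma vertex_pt_inj : injective (@vertex_pt R V).
Proof.
move=> v w /(congr1 (fun x => val x v)) /=; rewrite eqxx.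
by have [//|_ /eqP] := eqVneq v w; rewrite oner_eq0.
Qed.

(** This condition and [mass x s = 1] are preserved by affine combinations and hence hold on the
    affine hull of the simplex on [s]; adding nonnegativity of the coordinates characterises the
    closed simplex. *)
Definition supported x s := forall v, ~ s v -> val x v = 0.

Definition mass x s : R := \sum_(v \in s) val x v.

Lemma mass_vertex v s : finite_set s -> s v -> mass (vertex_pt R v) s = 1.
Proof.
move=> fs sv; rewrite /mass fsbig_finite//.
have vs : v \in fset_set s by rewrite in_fset_set// inE.
rewrite (big_fsetD1 v)//= eqxx big1_fset ?addr0// => w.
by rewrite !inE => /andP[/negPf->].
Qed.

Lemma supported_vertex v s : s v -> supported (vertex_pt R v) s.
Proof. by move=> sv w nsw /=; have [wv|//] := eqVneq w v; case: nsw; rewrite wv. Qed.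

Lemma mass_combination (I : Type) (r : seq I) (t : I -> R) (F : I -> E) s :
  finite_set s -> mass (\sum_(i <- r) t i *: F i) s = \sum_(i <- r) t i * mass (F i) s.
Proof.
move=> fs; rewrite /mass fsbig_finite//.
under eq_bigr do rewrite val_sum.
rewrite exchange_big /=; apply: eq_bigr => i _.
by rewrite fsbig_finite// mulr_sumr.
Qed.

Lemma supported_combination (I : eqType) (r : seq I) (t : I -> R) (F : I -> E) s :
  (forall i, i \in r -> t i != 0 -> supported (F i) s) ->
  supported (\sum_(i <- r) t i *: F i) s.
Proof.
move=> Fs v nsv; rewrite val_sum big1_seq// => i /andP[_ ir].
rewrite free_normedZE; have [->|ti] := eqVneq (t i) 0; first by rewrite mul0r.
by rewrite Fs ?mulr0.
Qed.

(** A sum with infinite support would be 0 by convention, so the value 1 forces finitely many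
    nonzero weights. *)
Lemma fsum_finite_combination (A : set E) (t : E -> R) :
  \sum_(a \in A) t a = 1 -> exists r : seq E, [/\ forall a, a \in r -> A a,
    \sum_(a <- r) t a = 1 & \sum_(a \in A) t a *: a = \sum_(a <- r) t a *: a].
Proof.
move=> t1; pose B := A `&` t @^-1` [set~ 0].
have fB : finite_set B.
  apply: contrapT => iB; move: t1; rewrite fsbig_dflt// => /esym/eqP.
  by rewrite oner_eq0.
exists (fset_set B); split=> [a||].
- by rewrite in_fset_set// inE => -[].
- by rewrite -t1 [RHS]fsbig_supp fsbig_finite.
- rewrite -fsbig_finite//; apply/esym/fsbig_widen => [a []//|a [Aa nBa]] /=.
  have [->|ta] := eqVneq (t a) 0; first by rewrite scale0r.
  by case: nBa; split=> //; exact/eqP.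
Qed.

Lemma closed_simplexP s x : finite_set s ->
  closed_simplex s x <->
  [/\ forall v, 0 <= val x v, supported x s & mass x s = 1].
Proof.
move=> fs; split=> [[t [t0 t1 ->]]|[x0 xs x1]].
  have [r [rs r1 ->]] := fsum_finite_combination t1.
  split=> [v||].
  - rewrite val_sum big_seq sumr_ge0// => a ar; rewrite free_normedZE mulr_ge0//.
      by apply: t0; exact: rs.
    by have [w sw <-] := rs _ ar; rewrite /=; case: ifP.
  - apply: supported_combination => a /rs[w sw <-] _; exact: supported_vertex.
  - rewrite mass_combination// -r1 big_seq [RHS]big_seq; apply: eq_bigr => a.
    by move=> /rs[w sw <-]; rewrite mass_vertex// mulr1.
(* The hull takes weights indexed by points of [E]: a vertex point receives the coordinate of [x] at
   its vertex, which is unique by injectivity of [vertex_pt], and all other points receive 0. *)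
pose t (a : E) : R :=
  if pselect (exists v, a = vertex_pt R v) is left av then val x (projT1 (cid av)) else 0.
have tE v : t (vertex_pt R v) = val x v.
  rewrite /t; case: pselect => [av|[]]; last by exists v.
  by case: cid => w /= /vertex_pt_inj ->.
have inj : set_inj s (@vertex_pt R V) by move=> v w _ _; exact: vertex_pt_inj.
exists t; split.
- by move=> _ [v _ <-]; rewrite tE.
- by rewrite fsbig_image// -x1; apply: eq_fsbigr => v _; exact: tE.
- rewrite fsbig_image//; apply/val_inj/funext => v.
  have -> : \sum_(w \in s) t (vertex_pt R w) *: vertex_pt R w =
      \sum_(w \in s) val x w *: vertex_pt R w.
    by apply: eq_fsbigr => w _; rewrite tE.
  have [sv|nsv] := pselect (s v); first by rewrite val_fsum_vertex.
  rewrite xs// fsbig_finite// (@supported_combination _ _ _ _ s)// => w.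
  by rewrite in_fset_set// inE => sw _; exact: supported_vertex.
Qed.

Lemma closed_simplex_combination (I : finType) (t : I -> R) (w : I -> V) s :
  finite_set s -> (forall i, 0 <= t i) -> (forall i, t i != 0 -> s (w i)) ->
  \sum_i t i = 1 -> closed_simplex s (\sum_i t i *: vertex_pt R (w i)).
Proof.
move=> fs t0 tw t1; apply/closed_simplexP => //; split.
- move=> v; rewrite val_sum sumr_ge0// => i _; rewrite free_normedZE mulr_ge0//=.
  by case: ifP.
- by apply: supported_combination => i _ /tw; exact: supported_vertex.
- rewrite mass_combination// -t1; apply: eq_bigr => i _.
  have [->|/tw ti] := eqVneq (t i) 0; first by rewrite mul0r.
  by rewrite mass_vertex// mulr1.
Qed.

Lemma affine_hull_closed_simplex s x : finite_set s ->
  affine_hull (closed_simplex s) x -> supported x s /\ mass x s = 1.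
Proof.
move=> fs [t [t1 ->]]; have [r [rs r1 ->]] := fsum_finite_combination t1; split.
  by apply: supported_combination => a /rs /(closed_simplexP _ fs)[].
rewrite mass_combination// -r1 big_seq [RHS]big_seq; apply: eq_bigr => a.
by move=> /rs/(closed_simplexP _ fs)[_ _ ->]; rewrite mulr1.
Qed.

(** If the coordinate at [v] were 0, moving from [x] slightly away from the vertex [v] would leave
    the simplex inside its affine hull. Conversely, positivity of finitely many coordinates is an
    open condition. *)
Lemma open_simplexP s x : finite_set s ->
  open_simplex s x <-> closed_simplex s x /\ forall v, s v -> 0 < val x v.
Proof.
move=> fs; split=> [[sx wx]|[sx x0]]; split=> //.
  move=> v sv; have [x0 _ _] := (closed_simplexP x fs).1 sx.
  rewrite lt_neqAle x0 andbT eq_sym; apply/eqP => xv.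
  pose e := vertex_pt R v.
  have xe : x != e.
    apply/eqP => /(congr1 (fun y => val y v)) /=.
    by rewrite xv eqxx => /esym/eqP; rewrite oner_eq0.
  have se : closed_simplex s e.
    apply/closed_simplexP => //; split.
    - by move=> w /=; case: ifP.
    - exact: supported_vertex.
    - exact: mass_vertex.
  have [d d0 dP] := (nbhs_normP x _).1 wx.
  (* This choice makes the norm of [k *: (x - e)] less than [d], so that [y] stays in the ball on
     which [dP] applies. *)
  pose k := d / (2 * (`|x - e| + 1)).
  have ne : 0 <= `|x - e| by [].
  have k0 : 0 < k by rewrite divr_gt0// mulr_gt0//; lra.
  pose y := x + k *: (x - e).
  have : closed_simplex s y.
    apply: dP.
      rewrite /= /y opprD addrA subrr add0r normrN normrZ gtr0_norm//.
      by rewrite /k mulrAC ltr_pdivrMr ?ltr_pM2l //; lra.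
    (* These weights write [y] as the affine combination [(1 + k) *: x - k *: e]; its coordinate at
       [v] is [- k], which is negative. *)
    pose t (a : E) : R := if a == x then 1 + k else if a == e then - k else 0.
    have sub : [set` [:: x; e]] `<=` closed_simplex s.
      by move=> a; rewrite /= !inE => /orP[] /eqP ->.
    have uq : uniq [:: x; e] by rewrite /= inE xe.
    have tN a : (closed_simplex s `\` [set` [:: x; e]]) a -> t a = 0.
      move=> [_ /negP]; rewrite /= !inE negb_or => /andP[/negPf ax /negPf ae].
      by rewrite /t ax ae.
    have tx : t x = 1 + k by rewrite /t eqxx.
    have te : t e = - k by rewrite /t eq_sym (negPf xe) eqxx.
    exists t; split.
      rewrite -(fsbig_widen [set` [:: x; e]] (closed_simplex s))//.
      by rewrite -fsbig_seq// !big_cons big_nil tx te /= addr0 addrK.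
    have -> : \sum_(a \in closed_simplex s) t a *: a =
        \sum_(a \in [set` [:: x; e]]) t a *: a.
      by apply/esym/fsbig_widen => // a /tN /= ->; rewrite scale0r.
    rewrite -fsbig_seq// !big_cons big_nil tx te /= addr0 scalerDl scale1r scaleNr.
    by rewrite /y scalerBr addrA.
  move=> /(closed_simplexP _ fs)[/(_ v) + _ _].
  have ev : val (- e) v = -1.
    by rewrite -scaleN1r free_normedZE /= eqxx mulr1.
  rewrite free_normedDE free_normedZE free_normedDE xv ev !add0r mulrN1.
  by rewrite oppr_ge0 leNgt k0.
have [_ xs x1] := (closed_simplexP x fs).1 sx.
have : nbhs x (\bigcap_(v in [set` fset_set s]) [set y : E | 0 < val y v]).
  apply: filter_bigI => v; rewrite in_fset_set// inE => sv.
  by apply: open_nbhs_nbhs; split; [exact: coord_open (@open_gt R 0)|exact: x0].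
apply: filterS => y y0 /(affine_hull_closed_simplex fs)[ys y1].
apply/closed_simplexP => //; split=> // v.
have [sv|/ys ->//] := pselect (s v).
by apply/ltW/y0; rewrite /= in_fset_set// inE.
Qed.

(** A point lies in the open simplex spanned by the support [u] of its coordinates, a face of any
    simplex containing the point. *)
Lemma open_starP S v x :
  open_star S v x <-> polyhedron S x /\ val x v != 0.
Proof.
split=> [[s [Ss sv]] /(open_simplexP _ (simplex_finite Ss))[sx x0]|[[s Ss sx] xv]].
  by split; [exists s|rewrite gt_eqF// x0].
have fs := simplex_finite Ss.
have [x0 xs x1] := (closed_simplexP x fs).1 sx.
pose u := [set w | val x w != 0].
have us : u `<=` s by move=> w /eqP xw; apply: contrapT => /xs.
have Su : simplices S u by apply: simplex_face Ss _ us; exists v.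
have fu := simplex_finite Su.
exists u => //; apply/open_simplexP => //; split; last first.
  by move=> w xw; rewrite lt_neqAle eq_sym xw x0.
apply/closed_simplexP => //; split=> //.
  by move=> w /negP; rewrite negbK => /eqP.
by rewrite -x1; apply: fsbig_widen => // w [_ /negP] /=; rewrite negbK => /eqP.
Qed.

Lemma polyhedron_coord_neq0 S x : polyhedron S x -> exists v, val x v != 0.
Proof.
move=> [s Ss /(closed_simplexP _ (simplex_finite Ss))[_ _ x1]].
apply: contrapT => x0; move: x1; rewrite /mass fsbig1 => [/esym/eqP|v _].
  by rewrite oner_eq0.
by apply/eqP; apply: contrapT => /negP xv; apply: x0; exists v.
Qed.

Lemma polyhedron_coord_vertex S x v : polyhedron S x -> val x v != 0 -> vertices S v.
Proof.
move=> [s Ss /(closed_simplexP _ (simplex_finite Ss))[_ xs _]] xv.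
by exists s => //; apply: contrapT => /xs xv0; rewrite xv0 eqxx in xv.
Qed.

Lemma polyhedronS S S' : simplices S `<=` simplices S' ->
  (polyhedron S : set E) `<=` polyhedron S'.
Proof. by move=> SS' x [s /SS' Ss sx]; exists s. Qed.

(** * Continuity for the Whitehead topology *)

Lemma realisation_valP S (x : realisation R S) : polyhedron S (val x).
Proof. exact: set_mem (valP x). Qed.

Lemma realisation_val_continuous S : continuous (val : realisation R S -> E).
Proof.
apply/continuousP => W oW.
suff : whitehead_open (S := S) (val @^-1` W) by [].
move=> s Ss; exists W => //.
apply/seteqP; split=> [_ [[y Wy <-]]//|x [Wx sx]]; split=> //.
have xS : x \in polyhedron S by rewrite inE; exists s.
by exists (exist (fun x => x \in polyhedron S) x xS).
Qed.

(** The Whitehead and norm topologies agree on a single closed simplex, so continuity can be checked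
    in norm at a point near which [f] stays in one simplex. *)
Lemma continuous_at_realisation (T : topologicalType) S (f : T -> realisation R S)
    (x : T) s : simplices S s -> (\forall y \near x, closed_simplex s (val (f y))) ->
  {for x, continuous (val \o f)} -> {for x, continuous f}.
Proof.
move=> Ss fs cf N; rewrite {1}nbhsE => -[B [oB Bx] BN].
have [W oW BW] : exists2 W : set E, open W &
  (val @` B) `&` closed_simplex s = W `&` closed_simplex s := oB s Ss.
have Wx : W (val (f x)).
  have : ((val @` B) `&` closed_simplex s) (val (f x)).
    by split; [exists (f x)|exact: nbhs_singleton fs].
  by rewrite BW => -[].
have := cf _ (open_nbhs_nbhs (conj oW Wx)); rewrite /= => Wf.
apply: filterS2 fs Wf => y sy Wy; apply: BN.
have : ((val @` B) `&` closed_simplex s) (val (f y)) by rewrite BW.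
by move=> [[z Bz /val_inj <-]].
Qed.

End barycentric_coordinates.

(** * From canonical maps to C-refinements *)

Section canonical_maps.
Local Open Scope classical_set_scope.
Local Open Scope ring_scope.
Context {R : realType} {X : topologicalType}.
Implicit Types (U V : nat -> set (set X)) (kappa : ordinal2).

Lemma Delta_simplices_nerve U kappa :
  simplices (Delta kappa U) `<=` simplices (nerve ord_omega U).
Proof. by move=> s [[fs s0 sU sx] _]; split=> // v /sU[]. Qed.

Lemma Delta_coord_inj U kappa (x : free_normed R (set X * nat)%type) v w :
  polyhedron (Delta kappa U) x -> val x v != 0 -> val x w != 0 -> v.2 = w.2 -> v = w.
Proof.
move=> [s Ss /(closed_simplexP _ (simplex_finite Ss))[_ xs _]] xv xw.
by apply: Ss.2; apply: contrapT => /xs/eqP; apply/negP.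
Qed.

Lemma canonical_map_C_refinement U kappa (f : X -> realisation R (Delta kappa U)) :
  canonical_map f -> exists V, C_refinement U kappa V.
Proof.
move=> [cf fU]; pose star (v : set X * nat) := [set x : X | val (val (f x)) v != 0].
exists (fun n => [set star (A, n) | A in U n]).
split=> [n nk|].
  split=> [B B' [A UA <-] [A' UA' <-] [x [xA xA']]|_ [A UA <-]|_ [A UA <-]].
  - by have [->] := Delta_coord_inj (realisation_valP (f x)) xA xA' erefl.
  - apply: (@open_comp _ _ f (val @^-1` [set z | val z (A, n) != 0])) => [x _|].
      exact: cf.
    apply: open_comp => [x _|]; first exact: realisation_val_continuous.
    by apply: (@coord_open R _ [set r | r != 0]); exact: open_neq.
  - exists A => // x xA.
    (* Canonicity concerns stars in the nerve of the whole sequence, so [f x] is first viewed there;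
       its nonzero coordinate then puts it in the open star of [(A, n)]. *)
    have fx : polyhedron (nerve ord_omega U) (val (f x)).
      by apply: polyhedronS (realisation_valP (f x)); exact: Delta_simplices_nerve.
    apply: (fU (A, n)); first exact: polyhedron_coord_vertex xA.
    exact/open_starP.
apply/seteqP; split=> // x _.
have fx := realisation_valP (f x).
have [[A n] xA] := polyhedron_coord_neq0 fx.
have [s [[_ _ sU _] _] /sU[nk UA]] := polyhedron_coord_vertex fx xA.
by exists (star (A, n)) => //; exists n => //; exists A.
Qed.

(** * From C-refinements to canonical maps *)

(** This compares the sums truncated at the bounds [m x] and [m y] attached to two nearby points. *)
Lemma sum_ord_eq (M : nmodType) (F : nat -> M) (m k : nat) :
  (forall n, (m <= n)%N -> F n = 0) -> (forall n, (k <= n)%N -> F n = 0) ->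
  \sum_(n < m) F n = \sum_(n < k) F n.
Proof.
wlog mk : m k / (m <= k)%N => [sumE m0 k0|m0 _].
  by have [mk|/ltnW km] := leqP m k; [exact: sumE|apply/esym/sumE].
rewrite -!(big_mkord xpredT) [RHS](big_cat_nat _ mk)//= [X in _ + X]big_nat_cond.
by rewrite [X in _ + X]big1 ?addr0// => n /andP[/andP[/m0]].
Qed.

Lemma C_refinement_canonical_map U V kappa :
  paracompact X -> hausdorff_space X -> C_refinement U kappa V ->
  exists f : X -> realisation R (Delta kappa U), canonical_map f.
Proof.
move=> paraX hausX [VP cV].
(* Nothing is known about [V n] at levels outside [kappa]; the first condition makes [W n] empty
   there. *)
pose W n := [set x | (ord_fin n < kappa)%O /\ exists2 B, V n B & B x].
have oW n : open (W n).
  have [nk|nk] := boolP (ord_fin n < kappa)%O; last first.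
    rewrite (_ : W n = set0); first exact: open0.
    by rewrite -subset0 => x [nk']; rewrite nk' in nk.
  rewrite (_ : W n = \bigcup_(B in V n) B).
    by apply: bigcup_open => B VB; have [_ oV _] := VP _ nk; exact: oV.
  by apply/seteqP; split=> [x [_ [B VB Bx]]|x [B VB Bx]]; [exists B|split=> //; exists B].
have cW : \bigcup_n W n = setT.
  apply/seteqP; split=> // x _.
  have : [set: X] x by [].
  rewrite -cV => -[B [n nk VB] Bx].
  by exists n => //; split=> //; exists B.
have [xi [cxi xi0 xiW xi1]] :=
  @paracompact_hausdorff_partition R X W paraX hausX oW cW.
have xi_W n x : xi n x != 0 -> W n x.
  by move=> /eqP xin; apply: contrapT => /xiW/nbhs_singleton.
(* For [x] in [W n], this is the only member of [V n] containing [x]. *)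
pose b n (x : X) := \bigcup_(B in [set B | V n B /\ B x]) B.
have bE n B x : (ord_fin n < kappa)%O -> V n B -> B x -> b n x = B.
  move=> nk VB Bx; have [tV _ _] := VP _ nk.
  apply/seteqP; split=> [y [B' [VB' B'x] B'y]|y By]; last by exists B.
  by rewrite (tV B B')//; exists x.
have /choice [u uP] n : exists u : set X -> set X, (ord_fin n < kappa)%O ->
    forall B, V n B -> U n (u B) /\ B `<=` u B.
  have [nk|_] := boolP (ord_fin n < kappa)%O; last by exists id.
  have [_ _ rV] := VP _ nk.
  have /choice [u uP] B : exists A, V n B -> U n A /\ B `<=` A.
    have [/rV[A UA BA]|nVB] := pselect (V n B); first by exists A.
    by exists set0.
  by exists u.
pose vtx n x : set X * nat := (u n (b n x), n).
have vtxP n x : W n x -> disjoint_union kappa U (vtx n x) /\ (vtx n x).1 x.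
  move=> [nk [B VB Bx]]; rewrite /disjoint_union /vtx /= (bE _ _ _ nk VB Bx).
  by have [UuB] := uP _ nk _ VB; split=> //; exact: (_ : B `<=` _).
(* This will be the simplex carrying the map near [x]: its kernel contains [x], and it has at most
   one vertex per level. *)
pose s m x := [set vtx n x | n in [set n | (n < m)%N /\ W n x]].
have fs m x : finite_set (s m x).
  by apply: finite_image; apply: sub_finite_set (finite_II m) => n [].
(* The vertices are frozen at [x] while the weights vary with [y]; the map itself is
   [g (m x) x x]. *)
pose g m x y : free_normed R (set X * nat)%type :=
  \sum_(n < m) xi n y *: vertex_pt R (vtx n x).
have /choice [m mP] := xi1.
have Ss x : simplices (Delta kappa U) (s (m x) x).
  have [_ mx] := nbhs_singleton (mP x).
  split; last by move=> _ _ [n _ <-] [k _ <-] /= ->.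
  split=> //.
  - apply: contrapT => s0; move: mx; rewrite big1 => [/esym/eqP|n _].
      by rewrite oner_eq0.
    by apply/eqP; apply: contrapT => /negP/xi_W Wx; apply: s0; exists (vtx n x); exists n.
  - by move=> _ [n [_ /vtxP[? _]] <-].
  - by exists x => _ [n [_ /vtxP[_ ?]] <-].
(* For each of the finitely many levels below [m x], either [x] lies in [W n] or [xi n] vanishes
   near [x]. *)
have nearW x : \forall y \near x, forall n : 'I_(m x), xi n y != 0 -> W n x.
  apply: filter_forall => n; have [Wx|/xiW] := pselect (W n x).
    exact: filterS filterT.
  by apply: filterS => y ->; rewrite eqxx.
have near_vtx x : \forall y \near x, forall n : 'I_(m x), W n x -> vtx n y = vtx n x.
  apply: filter_forall => n.
  have [[nk [B VB Bx]]|nWx] := pselect (W n x); last exact: filterS filterT.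
  have [_ oV _] := VP _ nk.
  have := open_nbhs_nbhs (conj (oV _ VB) Bx); apply: filterS => y By _.
  by rewrite /vtx !(bE _ B).
have gs x : \forall y \near x, closed_simplex (s (m x) x) (g (m x) x y).
  apply: filterS2 (mP x) (nearW x) => y [_ y1] yW.
  apply: closed_simplex_combination => // n xin.
  by exists n => //; split=> //; exact: yW.
have fP x : g (m x) x x \in polyhedron (Delta kappa U).
  by rewrite inE; exists (s (m x) x) => //; exact: nbhs_singleton (gs x).
pose f x : realisation R (Delta kappa U) :=
  exist (fun z => z \in polyhedron (Delta kappa U)) _ (fP x).
exists f; split=> [x|v vN x].
  have gE : \forall y \near x, g (m x) x y = g (m y) y y.
    apply: filterS3 (mP x) (nearW x) (near_vtx x) => y [x0 _] yW yv.
    have [y0 _] := nbhs_singleton (mP y).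
    have -> : g (m x) x y = g (m x) y y.
      apply: eq_bigr => n _.
      by have [->|/yW/yv ->//] := eqVneq (xi n y) 0; rewrite !scale0r.
    apply: (sum_ord_eq (F := fun n => xi n y *: vertex_pt R (vtx n y))) => n.
      by move/x0 => ->; rewrite scale0r.
    by move/y0 => ->; rewrite scale0r.
  apply: (continuous_at_realisation (Ss x)).
    by apply: filterS2 gE (gs x) => y /= <-.
  have cg : g (m x) x @ x --> g (m x) x x.
    apply: (@cvg_big (free_normed R (set X * nat)%type) _ +%R 0 xpredT
      (@add_continuous _)) => n _.
    by apply: cvgZ; [exact: cxi|exact: cvg_cst].
  by move=> A /cg; apply: filterS2 gE => y /= <-.
move=> /open_starP[_ fv].
(* A nonzero coordinate at [v] can only come from a vertex [vtx n x] of nonzero weight, and the set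
   it represents contains [x]. *)
have [n <- xin] : exists2 n, vtx n x = v & xi n x != 0.
  apply: contrapT => nv; move/negP: fv; apply; apply/eqP.
  rewrite /= val_sum big1// => n _; rewrite free_normedZE /=.
  have [vn|_] := eqVneq v (vtx n x); last by rewrite mulr0.
  rewrite mulr1; apply/eqP; apply: contrapT => /negP xin.
  by apply: nv; exists n.
by have [] := vtxP _ _ (xi_W _ _ xin).
Qed.

End canonical_maps.

Theorem theorem6p1 (R : realType) (X : topologicalType)
    (paraX : paracompact X) (hausX : hausdorff_space X)
    (mu : ordinal2) (mu_gt0 : (ord_fin 0 < mu)%O)
    (mu_le : (mu <= ord_omegaS)%O) :
  (forall U : nat -> set (set X), (forall n, is_open_cover (U n)) ->
     exists kappa : ordinal2, (ord_fin 0 < kappa < mu)%O /\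
       exists V : nat -> set (set X), C_refinement U kappa V)
  <->
  (forall U : nat -> set (set X), (forall n, is_open_cover (U n)) ->
     exists kappa : ordinal2, (ord_fin 0 < kappa < mu)%O /\
       exists f : X -> realisation R (Delta kappa U), canonical_map f).
Proof.
split=> ab U /ab[kappa [kappa_mu]].
- by move=> [V /(C_refinement_canonical_map paraX hausX) fU]; exists kappa.
- by move=> [f /canonical_map_C_refinement VU]; exists kappa.
Qed.
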